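(* A real-valued frame $\Phi\subseteq\mathbb{R}^2$ is conjugate phase retrievable (on $\mathbb{C}^2$) if and only if $\Phi$ has the complement property.
   Context: A frame for $\mathbb{C}^2$ is a finite family $\Phi=\{\varphi_n\}_{n=1}^N$ spanning $\mathbb{C}^2$; it is real-valued if all its vectors have real entries. $\Phi$ is conjugate phase retrievable on $\mathbb{C}^2$ if for all $x,y\in\mathbb{C}^2$, $|\langle x,\varphi_n\rangle|=|\langle y,\varphi_n\rangle|$ for all $n$ implies that there is $\theta\in\mathbb{R}$ with $x=e^{i\theta}y$ or $x=e^{i\theta}\overline{y}$, where $\overline{y}$ is the coordinatewise conjugate. $\{\varphi_n\}_{n=1}^N$ has the complement property (in $\mathbb{C}^2$) if for every subset $I\subseteq\{1,\ldots,N\}$, $\mathrm{span}\{\varphi_n:n\in I\}=\mathbb{C}^2$ or $\mathrm{span}\{\varphi_n:n\in I^c\}=\mathbb{C}^2$ (complex span). *)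

(* Defs.v *)
From HB Require Import structures.
From mathcomp Require Import all_boot all_order all_algebra.
From mathcomp Require Import complex.
From mathcomp Require Import reals trigo.

Set Implicit Arguments.
Unset Strict Implicit.
Unset Printing Implicit Defensive.

Import Order.TTheory GRing.Theory Num.Theory.

Local Open Scope ring_scope.
Local Open Scope complex_scope.

(* A family {phi_1, ..., phi_N} of C^d is a function 'I_N -> 'rV[R[i]]_d;
   repetitions and zero vectors are allowed. *)

Definition spanning_on (R : realType) (d N : nat)
    (phi : 'I_N -> 'rV[R[i]]_d) (I : {set 'I_N}) : Prop :=
  <<[seq phi n | n in I]>>%VS = fullv.

Definition is_frame (R : realType) (d N : nat)
    (phi : 'I_N -> 'rV[R[i]]_d) : Prop :=
  spanning_on phi [set: 'I_N].

Definition real_valued (R : realType) (d N : nat)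
    (phi : 'I_N -> 'rV[R[i]]_d) : Prop :=
  forall n, phi n \is a mxOver Num.real.

Definition expi (R : realType) (t : R) : R[i] := cos t +i* sin t.

(* [dotmx x y] is \sum_k x_k * (y_k)^*. *)
Definition conjugate_phase_retrievable (R : realType) (d N : nat)
    (phi : 'I_N -> 'rV[R[i]]_d) : Prop :=
  forall x y : 'rV[R[i]]_d,
    (forall n, `|dotmx x (phi n)| = `|dotmx y (phi n)|) ->
    exists t : R, x = expi t *: y \/ x = expi t *: map_mx Num.conj y.

Definition complement_property (R : realType) (d N : nat)
    (phi : 'I_N -> 'rV[R[i]]_d) : Prop :=
  forall I : {set 'I_N}, spanning_on phi I \/ spanning_on phi (~: I).

(* Main.v *)
Require Import Defs.
From mathcomp Require Import all_boot all_order all_algebra.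
From mathcomp Require Import complex.
From mathcomp Require Import reals.
From mathcomp Require Import trigo ring.

(** Write |<x, v>|^2 = x_0 x_0^* p^2 + (x_0 x_1^* + x_0^* x_1) p q + x_1 x_1^* q^2
    for a real vector v = (p, q).  The measurement is thus the value at (p, q)
    of a binary quadratic form whose three coefficients depend on x, and these
    coefficients determine x exactly up to a phase and a conjugation: they give
    |x_0|, |x_1|, the sum and the product of x_0 x_1^* and its conjugate, so
    x_0 x_1^* up to conjugation ([phase_or_conj]).

    If the complement property holds, remove from the frame all the multiples
    of one nonzero vector a: what remains must span, hence contains two
    independent vectors b, c, and a, b, c lie on three distinct lines.  A
    nonzero binary quadratic form vanishes on at most two lines
    ([quadratic_form_eq0]), so three such measurements determine the form, and
    the frame does conjugate phase retrieval.

    If the property fails for I, the vectors indexed by I lie on a real line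
    through some u, the others on a real line through some v.  Rotating u + v
    and u - v by a right angle gives real signals x, y with
    <x, w> = det(u, w) + det(v, w) and <y, w> = det(u, w) - det(v, w), which
    have the same modulus when one of the determinants vanishes.  As y is its
    own conjugate, retrievability would give x = c y, hence u and v would be
    proportional and the whole frame would lie on one line ([cross_line]). *)

Set Implicit Arguments.
Unset Strict Implicit.
Unset Printing Implicit Defensive.

Import Order.TTheory GRing.Theory Num.Theory.

Local Open Scope ring_scope.

(** * Planar determinants and spanning families *)

Definition cross (F : fieldType) (u v : 'rV[F]_2) : F :=
  u 0 0 * v 0 1 - u 0 1 * v 0 0.

Lemma rV2P (T : Type) (u v : 'rV[T]_2) :
  u 0 0 = v 0 0 -> u 0 1 = v 0 1 -> u = v.
Proof.
move=> e0 e1; apply/rowP => i.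
have [->|->] // : i = 0 \/ i = 1.
by case: i => [[|[|//]] lti]; [left|right]; apply/val_inj.
Qed.

Lemma cross_neq0l (F : fieldType) (u v : 'rV[F]_2) : cross u v != 0 -> u != 0.
Proof. by apply: contraNneq => ->; rewrite /cross !mxE !mul0r subrr. Qed.

Lemma crossZl (F : fieldType) (k : F) (u v : 'rV[F]_2) :
  cross (k *: u) v = k * cross u v.
Proof. by rewrite /cross !mxE; ring. Qed.

Lemma crossDl (F : fieldType) (u v w : 'rV[F]_2) :
  cross (u + v) w = cross u w + cross v w.
Proof. by rewrite /cross !mxE; ring. Qed.

Lemma crossNl (F : fieldType) (u v : 'rV[F]_2) : cross (- u) v = - cross u v.
Proof. by rewrite /cross !mxE; ring. Qed.

Lemma crossvv (F : fieldType) (u : 'rV[F]_2) : cross u u = 0.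
Proof. by rewrite /cross; ring. Qed.

Lemma cross_eq0_scale (F : fieldType) (u v : 'rV[F]_2) :
  u != 0 -> cross u v = 0 -> exists k, v = k *: u.
Proof.
move=> u0 /eqP; rewrite subr_eq0 => /eqP uv.
have [u00|u00] := eqVneq (u 0 0) 0.
  have u01 : u 0 1 != 0.
    by apply: contra u0 => /eqP u01; apply/eqP/rV2P; rewrite mxE.
  exists (v 0 1 / u 0 1); apply: rV2P; rewrite mxE; last by rewrite divfK.
  by apply: (mulfI u01); rewrite -uv u00; ring.
exists (v 0 0 / u 0 0); apply: rV2P; rewrite mxE; first by rewrite divfK.
by apply: (mulfI u00); rewrite uv; field.
Qed.

Lemma dim_fullv2 (F : fieldType) : \dim (fullv : {vspace 'rV[F]_2}) = 2.
Proof. by rewrite dimvf /dim /= mul1n. Qed.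

Lemma cross_line (F : fieldType) (X : seq 'rV[F]_2) (u : 'rV[F]_2) :
  u != 0 -> {in X, forall v, cross u v = 0} -> <<X>>%VS != fullv.
Proof.
move=> u0 Xu; apply/eqP => fX.
have : (<<X>> <= <[u]>)%VS.
  apply/span_subvP => v vX; apply/vlineP.
  exact: cross_eq0_scale (Xu _ vX).
by move=> /dimvS; rewrite fX dim_fullv2 dim_vline u0.
Qed.

(** Any nonzero member of [X] directs the line.  When all members vanish, every
    line works; the witness [const_mx 1] is then chosen because it is real. *)
Lemma pairwise_dependent_line (F : fieldType) (X : seq 'rV[F]_2) :
    {in X &, forall u v, cross u v = 0} ->
  exists u, [/\ u != 0, u \in const_mx 1 :: X & {in X, forall v, cross u v = 0}].
Proof.
move=> X2.
have [/hasP[u uX u0]|/hasPn X0] := boolP (has (fun u => u != 0) X).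
  by exists u; split=> [//||v vX]; rewrite ?inE ?uX ?orbT // X2.
exists (const_mx 1); rewrite mem_head; split=> // [|v /X0 /negPn/eqP ->].
  by apply/eqP => /rowP/(_ 0); rewrite !mxE; apply/eqP/oner_neq0.
by rewrite /cross !mxE !mulr0 subrr.
Qed.

(** A family of plane vectors either spans or lies on a line; both directions of
    the theorem rest on this alternative. *)
Lemma span_cross (F : fieldType) (X : seq 'rV[F]_2) :
  (<<X>>%VS == fullv) = has (fun u => has (fun v => cross u v != 0) X) X.
Proof.
apply/idP/hasP => [|[u uX /hasP[v vX uv]]].
  move=> fX; apply/hasP; apply: contraLR fX => /hasPn NX.
  have [u v uX vX|u [u0 _ Xu]] := @pairwise_dependent_line _ X.
    by have /hasPn/(_ v vX)/negPn/eqP := NX u uX.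
  exact: cross_line u0 Xu.
rewrite eqEsubv subvf; apply/subvP => w _.
(* Cramer's rule *)
have -> : w = (cross w v / cross u v) *: u + (cross u w / cross u v) *: v.
  by apply: rV2P; rewrite !mxE; move: uv; rewrite /cross => uv; field.
by rewrite memvD// memvZ// memv_span.
Qed.

Lemma real_line (C : numClosedFieldType) (X : seq 'rV[C]_2) :
    {in X, forall v, v \is a mxOver Num.real} -> <<X>>%VS != fullv ->
  exists u : 'rV[C]_2,
    [/\ u != 0, u \is a mxOver Num.real & {in X, forall v, cross u v = 0}].
Proof.
move=> Xre; rewrite span_cross => /hasPn NX.
have [u v uX vX|u [u0 u1X Xu]] := @pairwise_dependent_line _ X.
  by have /hasPn/(_ v vX)/negPn/eqP := NX u uX.
exists u; split=> //; move: u1X; rewrite inE => /predU1P[->|/Xre//].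
by apply/mxOverP => i j; rewrite mxE real1.
Qed.

(** * Recovering a signal from its quadratic form *)

(** The three vanishing conditions form a linear system in the coefficients whose
    determinant is, up to sign, the product of the three cross products. *)
Lemma quadratic_form_eq0 (F : fieldType) (a b c : 'rV[F]_2) (r s t : F) :
    let Q v := r * v 0 0 ^+ 2 + s * (v 0 0 * v 0 1) + t * v 0 1 ^+ 2 in
    cross a b != 0 -> cross a c != 0 -> cross b c != 0 ->
    Q a = 0 -> Q b = 0 -> Q c = 0 ->
  [/\ r = 0, s = 0 & t = 0].
Proof.
move=> Q ab ac bc Qa Qb Qc.
have d0 : cross a b * cross a c * cross b c != 0 by rewrite !mulf_neq0.
(* For a fixed column of the system, [k u v] is the cofactor of the remaining
   entry when the rows of [u] and [v] are kept. *)
have solve z (k : 'rV[F]_2 -> 'rV[F]_2 -> F) :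
    cross a b * cross a c * cross b c * z =
      Q a * k b c - Q b * k a c + Q c * k a b -> z = 0.
  rewrite Qa Qb Qc !mul0r subrr addr0 => /eqP.
  by rewrite mulf_eq0 (negPf d0) => /eqP.
split.
- apply: (solve _ (fun u v => u 0 1 * v 0 1 * cross u v)).
  by rewrite /Q /cross; ring.
- apply: (solve _ (fun u v => - (u 0 0 * v 0 1 + u 0 1 * v 0 0) * cross u v)).
  by rewrite /Q /cross; ring.
- apply: (solve _ (fun u v => u 0 0 * v 0 0 * cross u v)).
  by rewrite /Q /cross; ring.
Qed.

Lemma dotmx2 (C : numClosedFieldType) (x v : 'rV[C]_2) :
    v \is a mxOver Num.real ->
  dotmx x v = x 0 0 * v 0 0 + x 0 1 * v 0 1.
Proof.
move=> /mxOverP vre; rewrite dotmxE mxE big_ord_recl big_ord1 !mxE.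
have -> : lift ord0 ord0 = 1 :> 'I_2 by apply/val_inj.
by rewrite !conj_Creal ?vre.
Qed.

Lemma sqr_norm_dotmx2 (C : numClosedFieldType) (x v : 'rV[C]_2) :
    v \is a mxOver Num.real ->
  `|dotmx x v| ^+ 2 = x 0 0 * (x 0 0)^* * v 0 0 ^+ 2
    + (x 0 0 * (x 0 1)^* + (x 0 0)^* * x 0 1) * (v 0 0 * v 0 1)
    + x 0 1 * (x 0 1)^* * v 0 1 ^+ 2.
Proof.
move=> vre; rewrite normCK dotmx2 // rmorphD !rmorphM /=.
move/mxOverP: vre => vre.
by rewrite (conj_Creal (vre 0 0)) (conj_Creal (vre 0 1)); ring.
Qed.

(** A number and its conjugate are the two roots of a quadratic polynomial with
    coefficients their sum and product. *)
Lemma eq_or_conj (C : numClosedFieldType) (z w : C) :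
  z + z^* = w + w^* -> z * z^* = w * w^* -> z = w \/ z = w^*.
Proof.
move=> es ep; have : (z - w) * (z - w^*) = 0.
  have -> : (z - w) * (z - w^*) = z * z - z * (w + w^*) + w * w^* by ring.
  by rewrite -es -ep; ring.
by move/eqP; rewrite mulf_eq0 !subr_eq0 => /orP[]/eqP; [left|right].
Qed.

(** The hypotheses say that the rank-one matrices x^* x and y^* y agree.  The
    phase is the ratio of any two corresponding nonzero coordinates. *)
Lemma eq_phase (C : numClosedFieldType) (x y : 'rV[C]_2) :
    x 0 0 * (x 0 0)^* = y 0 0 * (y 0 0)^* ->
    x 0 1 * (x 0 1)^* = y 0 1 * (y 0 1)^* ->
    x 0 0 * (x 0 1)^* = y 0 0 * (y 0 1)^* ->
  exists c : C, `|c| = 1 /\ x = c *: y.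
Proof.
have norm_eq (z w : C) : z * z^* = w * w^* -> `|z| = `|w|.
  by rewrite -!normCK => /eqP; rewrite eqrXn2 // => /eqP.
move=> e0 e1 e01.
have n0 := norm_eq _ _ e0; have n1 := norm_eq _ _ e1.
have [y0|y0] := eqVneq (y 0 0) 0.
  have x0 : x 0 0 = 0 by apply: normr0_eq0; rewrite n0 y0 normr0.
  have [y1|y1] := eqVneq (y 0 1) 0.
    exists 1; split; first exact: normr1.
    rewrite scale1r; apply: rV2P; rewrite ?x0 ?y0 //.
    by rewrite y1; apply: normr0_eq0; rewrite n1 y1 normr0.
  exists (x 0 1 / y 0 1); split; first by rewrite normf_div n1 divff ?normr_eq0.
  by apply: rV2P; rewrite mxE ?divfK // x0 y0 mulr0.
exists (x 0 0 / y 0 0); split; first by rewrite normf_div n0 divff ?normr_eq0.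
apply: rV2P; rewrite mxE ?divfK //.
have y0J : (y 0 0)^* != 0 by rewrite conjC_eq0.
have e10 : (x 0 0)^* * x 0 1 = (y 0 0)^* * y 0 1.
  by have := congr1 Num.conj e01; rewrite !rmorphM /= !conjCK.
have : y 0 0 * x 0 1 = x 0 0 * y 0 1.
  apply: (mulfI y0J); rewrite mulrA [_^* * _]mulrC -e0 -mulrA e10; ring.
by move=> /(congr1 ( *%R (y 0 0)^-1)); rewrite mulKf // => ->; ring.
Qed.

(** Only the real part of x_0 x_1^* enters the quadratic form, and the moduli of
    x_0 and x_1 then fix its imaginary part up to sign.  The change of sign is
    the one produced by conjugating [y]. *)
Lemma phase_or_conj (C : numClosedFieldType) (x y : 'rV[C]_2) :
    x 0 0 * (x 0 0)^* = y 0 0 * (y 0 0)^* ->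
    x 0 1 * (x 0 1)^* = y 0 1 * (y 0 1)^* ->
    x 0 0 * (x 0 1)^* + (x 0 0)^* * x 0 1 =
      y 0 0 * (y 0 1)^* + (y 0 0)^* * y 0 1 ->
  exists c : C, `|c| = 1 /\ (x = c *: y \/ x = c *: map_mx Num.conj y).
Proof.
move=> e0 e1 es.
have [||e|e] := @eq_or_conj _ (x 0 0 * (x 0 1)^*) (y 0 0 * (y 0 1)^*).
- by rewrite !rmorphM /= !conjCK.
- rewrite !rmorphM /= !conjCK.
  have E (u w : C) : u * w^* * (u^* * w) = u * u^* * (w * w^*) by ring.
  by rewrite !E e0 e1.
- by have [c [c1 xy]] := eq_phase e0 e1 e; exists c; split; [|left].
have [|||c [c1 xy]] := @eq_phase _ x (map_mx Num.conj y).
- by rewrite !mxE conjCK e0 mulrC.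
- by rewrite !mxE conjCK e1 mulrC.
- by rewrite !mxE e rmorphM /= conjCK.
by exists c; split; [|right].
Qed.

Lemma expi_surj (R : realType) (c : R[i]%C) : `|c| = 1 -> exists t, c = expi t.
Proof.
case: c => a b /(congr1 (fun z => z ^+ 2)); rewrite -add_Re2_Im2 expr1n /=.
move=> /(@complexI R _ 1) ab1.
have ale : -1 <= a <= 1.
  by rewrite -ler_norml -(@ler_pXn2r _ 2) ?nnegrE // expr1n -normrX ger0_norm
    ?sqr_ge0 // -ab1 lerDl sqr_ge0.
have ca : cos (acos a) = a by rewrite acosK // in_itv.
have sa : sin (acos a) = `|b|.
  by rewrite sin_acos // -sqrtr_sqr; congr Num.sqrt; rewrite -ab1; ring.
have [b0|b0] := leP 0 b.
  by exists (acos a); rewrite /expi ca sa ger0_norm.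
by exists (- acos a); rewrite /expi cosN sinN ca sa ltr0_norm // opprK.
Qed.

(** * Signals that a split family cannot distinguish *)

(** The right-angle rotation that turns determinants into inner products: see
    [dotmx_perp]. *)
Definition perp (C : numClosedFieldType) (v : 'rV[C]_2) : 'rV[C]_2 :=
  \row_j (if j == 0 then - v 0 1 else v 0 0).

Lemma perpE (C : numClosedFieldType) (v : 'rV[C]_2) :
  (perp v 0 0 = - v 0 1) * (perp v 0 1 = v 0 0).
Proof. by rewrite !mxE. Qed.

Lemma perp_eqZ (C : numClosedFieldType) (c : C) (u v : 'rV[C]_2) :
  perp u = c *: perp v -> u = c *: v.
Proof.
move=> /rowP e; apply: rV2P; rewrite mxE; first by have := e 1; rewrite !mxE.
by apply: oppr_inj; have := e 0; rewrite !mxE -mulrN.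
Qed.

Lemma perp_conj (C : numClosedFieldType) (v : 'rV[C]_2) :
    v \is a mxOver Num.real ->
  map_mx Num.conj (perp v) = perp v.
Proof.
move=> /mxOverP vre.
by apply: rV2P; rewrite mxE !perpE /= ?rmorphN /= conj_Creal ?vre.
Qed.

(** Pairing the equation with v and with u gives D = c D and D = - c D for
    D = det(u, v). *)
Lemma addr_eq_subrZ (C : numClosedFieldType) (c : C) (u v : 'rV[C]_2) :
  u + v = c *: (u - v) -> cross u v = 0.
Proof.
move=> e.
have ev : cross u v = c * cross u v.
  by have := congr1 (fun w : 'rV[C]_2 => cross w v) e;
    rewrite /= crossZl !crossDl crossNl crossvv subr0 addr0.
have eu : cross v u = - (c * cross v u).
  by have := congr1 (fun w : 'rV[C]_2 => cross w u) e;
    rewrite /= crossZl !crossDl crossNl crossvv !add0r mulrN.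
have vu : cross v u = - cross u v by rewrite /cross; ring.
rewrite vu mulrN -ev opprK in eu.
have : cross u v *+ 2 = 0 by rewrite mulr2n -{1}eu addNr.
by move/eqP; rewrite mulrn_eq0 => /eqP.
Qed.

Lemma dotmx_perp (C : numClosedFieldType) (u v : 'rV[C]_2) :
    v \is a mxOver Num.real -> dotmx (perp u) v = cross u v.
Proof. by move=> vre; rewrite dotmx2 // !perpE /cross; ring. Qed.

(** * Conjugate phase retrieval and the complement property *)

Theorem theorem4p2 (R : realType) (N : nat) (phi : 'I_N -> 'rV[R[i]%C]_2)
    (phi_frame : is_frame phi) (phi_real : real_valued phi) :
  conjugate_phase_retrievable phi <-> complement_property phi.
Proof.
split.
- move=> cpr I.
  have [sI|nI] := eqVneq (<<[seq phi n | n in I]>>)%VS fullv; first by left.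
  have [sJ|nJ] := eqVneq (<<[seq phi n | n in ~: I]>>)%VS fullv; first by right.
  have allre (J : {set 'I_N}) :
      {in [seq phi n | n in J], forall v, v \is a mxOver Num.real}.
    by move=> v /imageP[n _ ->]; apply: phi_real.
  have [u [u0 ure uI]] := real_line (allre I) nI.
  have [v [v0 vre vJ]] := real_line (allre (~: I)) nJ.
  have uvre : u - v \is a mxOver Num.real.
    apply/mxOverP => i j; rewrite !mxE.
    by rewrite rpredB ?(mxOverP ure) ?(mxOverP vre).
  have [n|t txy] := cpr (perp (u + v)) (perp (u - v)).
    rewrite !dotmx_perp // !crossDl crossNl.
    have [nI'|nI'] := boolP (n \in I).
      by rewrite (uI _ (image_f phi nI')) !add0r normrN.
    have nJ' : n \in ~: I by rewrite inE.
    by rewrite (vJ _ (image_f phi nJ')) oppr0.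
  have uv : cross u v = 0.
    apply: (@addr_eq_subrZ _ (expi t)); apply: perp_eqZ.
    by case: txy => //; rewrite perp_conj.
  have [k vk] := cross_eq0_scale u0 uv.
  have k0 : k != 0 by apply: contraNneq v0 => k0; rewrite vk k0 scale0r.
  suff /eqP[] : <<[seq phi n | n in [set: 'I_N]]>>%VS != fullv by [].
  apply: (cross_line u0) => _ /imageP[n _ ->].
  have [nI'|nI'] := boolP (n \in I); first exact: uI (image_f phi nI').
  have nJ' : n \in ~: I by rewrite inE.
  apply: (mulfI k0); rewrite mulr0 -crossZl -vk; exact: vJ (image_f phi nJ').
- move=> cp x y xy.
  have spanE (I : {set 'I_N}) : spanning_on phi I ->
      exists i j, [/\ i \in I, j \in I & cross (phi i) (phi j) != 0].
    move=> /eqP; rewrite span_cross => /hasP[_ /imageP[i iI ->]].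
    by move=> /hasP[_ /imageP[j jI ->] ij]; exists i, j.
  have [a [a' [_ _ aa']]] := spanE _ phi_frame.
  have a0 := cross_neq0l aa'.
  (* The multiples of [phi a] do not span, so the other vectors do. *)
  have [|/spanE[b [c []]]] := cp [set n | cross (phi a) (phi n) == 0].
    move/eqP; rewrite (negPf (cross_line a0 _)) // => _ /imageP[n + ->].
    by rewrite inE => /eqP.
  rewrite !inE => ab ac bc.
  pose r := x 0 0 * (x 0 0)^* - y 0 0 * (y 0 0)^*.
  pose s := x 0 0 * (x 0 1)^* + (x 0 0)^* * x 0 1
    - (y 0 0 * (y 0 1)^* + (y 0 0)^* * y 0 1).
  pose t := x 0 1 * (x 0 1)^* - y 0 1 * (y 0 1)^*.
  have Qeq n : r * phi n 0 0 ^+ 2 + s * (phi n 0 0 * phi n 0 1)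
      + t * phi n 0 1 ^+ 2 = 0.
    have := congr1 (fun z => z ^+ 2) (xy n).
    rewrite !sqr_norm_dotmx2 // => /eqP; rewrite -subr_eq0 => /eqP <-.
    by rewrite /r /s /t; ring.
  have [] := @quadratic_form_eq0 _ (phi a) (phi b) (phi c) r s t ab ac bc.
  1-3: exact: Qeq.
  move=> /subr0_eq e0 /subr0_eq es /subr0_eq e1.
  have [z [/expi_surj[th ->] xz]] := phase_or_conj e0 e1 es.
  by exists th.
Qed.
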